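(* Let $n\geq 2$ and let $f:GL_n(R)\rightarrow\mathfrak{gl}_n(R)$ be a $\delta$-map which is a cocycle for the adjoint action, i.e. $f(g_1g_2)=f(g_1)+g_1f(g_2)g_1^{-1}$ for all $g_1,g_2\in GL_n(R)$, and assume $f$ is $\delta$-coherent. Then there exists $\nu\in R$ such that for all $g\in GL_n(R)$, $$f(g)=\nu\cdot\delta g\cdot g^{-1}.$$
   Context: $\delta$-algebraic setting: $R$ is a field of characteristic zero equipped with a derivation $\delta:R\rightarrow R$, and $R$ is $\delta$-closed (constrainedly closed in Kolchin's sense). $R^{\delta}=\{c\in R:\delta c=0\}$ is the field of constants. A map $f:GL_n(R)\rightarrow\mathfrak{gl}_n(R)$ is a $\delta$-map if there is $m$ and a matrix $F$ of polynomials with coefficients in $R$ in the entries of $x,x',\dots,x^{(m)}$ ($n\times n$ matrices of variables) and $\det(x)^{-1}$ such that $f(g)=F(g,\delta g,\dots,\delta^m g)$ for all $g$, with $\delta$ applied entrywise. $f$ is called $\delta$-coherent if for every algebraic subgroup $G\subset GL_n$ defined over $R^{\delta}$ (Zariski closed subgroup defined by polynomial equations with coefficients in $R^{\delta}$), with Lie algebra $L(G)\subset\mathfrak{gl}_n$, one has $f(G(R))\subset L(G)(R)$. *)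

(* Defs.v *)
From HB Require Import structures.
From mathcomp Require Import all_boot all_order all_algebra.
From mathcomp Require Import mpoly.
Set Implicit Arguments. Unset Strict Implicit. Unset Printing Implicit Defensive.
Import Order.TTheory GRing.Theory.
Local Open Scope ring_scope.

Section Defs.
Variable R : fieldType.

Definition derivation (d : R -> R) : Prop :=
  (forall a b, d (a + b) = d a + d b) /\ (forall a b, d (a * b) = a * d b + d a * b).

(* Differential polynomial of order <= m in one variable y, viewed as an
   ordinary polynomial in y, y', ..., y^(m) (variables 0..m); evaluation at a. *)
Definition deval (d : R -> R) (m : nat) (p : {mpoly R[m.+1]}) (a : R) : R :=
  p.@[fun k : 'I_m.+1 => iter k d a].

(* d-closed (= differentially closed / constrainedly closed, ordinary case),
   via Blum's axioms: if f has order exactly m (genuinely involves y^(m))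
   and g is nonzero of order < m, then f(a) = 0 /\ g(a) <> 0 for some a.
   (For m = 0 this includes algebraic closedness.) *)
Definition delta_closed (d : R -> R) : Prop :=
  forall (m : nat) (f g : {mpoly R[m.+1]}),
    (exists2 mo, mo \in msupp f & (0 < mo ord_max)%N) ->
    g != 0 ->
    (forall mo, mo \in msupp g -> mo ord_max = 0%N) ->
    exists a : R, deval d f a = 0 /\ deval d g a != 0.

Variable n : nat.

Definition mxcoord (A : 'M[R]_n) : 'I_(n * n) -> R := fun t => mxvec A 0 t.

Definition jet (d : R -> R) (m : nat) (g : 'M[R]_n) : 'I_(m.+1 * (n * n)) -> R :=
  fun t => mxvec (\matrix_(k < m.+1, l < n * n) mxvec (iter k (map_mx d) g) 0 l) 0 t.

(* f is a d-map: its entries are polynomials in the entries of g, dg, ...,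
   d^m g and det(g)^-1; equivalently P(jet)/det(g)^N with P polynomial. *)
Definition delta_map (d : R -> R) (f : 'M[R]_n -> 'M[R]_n) : Prop :=
  exists (m N : nat) (P : 'I_n -> 'I_n -> {mpoly R[m.+1 * (n * n)]}),
    forall g, g \in unitmx ->
      forall i j, f g i j = (P i j).@[@jet d m g] / (\det g) ^+ N.

Definition alg_subgroup_const (d : R -> R) (G : 'M[R]_n -> Prop) : Prop :=
  [/\ (forall g, G g -> g \in unitmx),
      G 1%:M,
      (forall g h, G g -> G h -> G (g *m h)),
      (forall g, G g -> G (invmx g)) &
      exists S : {mpoly R[n * n]} -> Prop,
        (forall p, S p -> forall mo, d (p@_mo) = 0) /\
        (forall g, g \in unitmx -> (G g <-> forall p, S p -> p.@[mxcoord g] = 0))].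

(* R-points of the Lie algebra of G: the Zariski tangent space at 1 of the
   Zariski closed set G, i.e. the kernel of the differentials at 1 of all
   polynomials vanishing on G. *)
Definition lie_alg (G : 'M[R]_n -> Prop) (A : 'M[R]_n) : Prop :=
  forall p : {mpoly R[n * n]}, (forall g, G g -> p.@[mxcoord g] = 0) ->
    \sum_(t < n * n) (p^`M(t)).@[mxcoord 1%:M] * mxcoord A t = 0.

Definition delta_coherent (d : R -> R) (f : 'M[R]_n -> 'M[R]_n) : Prop :=
  forall G, alg_subgroup_const d G ->
    forall g, G g -> lie_alg G (f g).

End Defs.

(* Main.v *)
Require Import Defs.
From HB Require Import structures.
From mathcomp Require Import all_boot all_order all_algebra.
From mathcomp Require Import mpoly.
From mathcomp Require Import ring.
Set Implicit Arguments. Unset Strict Implicit. Unset Printing Implicit Defensive.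
Import GRing.Theory.
Local Open Scope ring_scope.

(* If M is a constant matrix with M^2 proportional to M, the invertible matrices
   1 + b M form a subgroup cut out by linear equations over the constants, so
   coherence forces f (1 + b M) to be a multiple of M. For M = e_ij and e_ii
   this gives f (1 + a e_ij) = phi_ij(a) e_ij and
   f (1 + (a - 1) e_ii) = psi_i(a) e_ii. Commuting dilations with transvections,
   the cocycle identity yields
     phi_ij (ab) = a phi_ij b + ab psi_i a = a phi_ij b + ab psi_j a,
   and M = e_ii - e_ij yields phi_ij 1 = 0. Hence all phi_ij equal one
   derivation D, and psi_i a = D a / a. As D is a differential polynomial,
   D = nu d: if d t = 1, then D - D t * d kills N[t], whose jets are Zariski
   dense. So f agrees with nu * dlog on elementary matrices, which generate
   GL_n. *)

(** * Generation of the general linear group by elementary matrices *)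

Lemma mul_add1_delta (F : fieldType) n (i j : 'I_n) a (A : 'M[F]_n) r s :
  ((1%:M + a *: delta_mx i j) *m A) r s = A r s + (r == i)%:R * a * A j s.
Proof.
rewrite mulmxDl mul1mx -scalemxAl !mxE; congr (_ + _).
rewrite (bigD1 j) //= big1 => [|l ljne]; first by rewrite mxE eqxx andbT; ring.
by rewrite mxE (negPf ljne) andbF mul0r.
Qed.

(** Gaussian elimination, column by column, written with left factors. A zero pivot is repaired by
    adding a lower row to the pivot row instead of swapping rows. *)
Lemma unitmx_elementary_ind (F : fieldType) n (P : 'M[F]_n -> Prop) :
  (forall A, P A -> A \in unitmx) ->
  P 1%:M ->
  (forall i a A, a != 0 -> P A ->
     P ((1%:M + (a - 1) *: delta_mx i i) *m A)) ->
  (forall i j a A, i != j -> P A -> P ((1%:M + a *: delta_mx i j) *m A)) ->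
  forall A, A \in unitmx -> P A.
Proof.
move=> Punit P1 Pdil Ptv.
(* The matrices [c l *: delta_mx l k] with l in r have pairwise zero products because k is not in r,
   so the product of the transvections is 1 plus their sum. *)
have Pcol (k : 'I_n) (c : 'I_n -> F) (r : seq 'I_n) A : k \notin r -> P A ->
    P ((1%:M + \sum_(i <- r) c i *: delta_mx i k) *m A).
  elim: r A => [|i r IHr] A; first by rewrite big_nil addr0 mul1mx.
  rewrite inE negb_or eq_sym => /andP[ik kr] PA.
  have -> : 1%:M + \sum_(l <- i :: r) c l *: delta_mx l k =
      (1%:M + c i *: delta_mx i k) *m (1%:M + \sum_(l <- r) c l *: delta_mx l k).
    rewrite big_cons mulmxDr mulmx1 mulmxDl mul1mx mulmx_sumr
      [X in _ + (_ + X)]big1_seq.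
      by rewrite addr0 addrA.
    move=> l /= lr; rewrite -scalemxAl -scalemxAr mul_delta_mx_0 ?scaler0 //.
    by apply: contraNneq kr => ->.
  by rewrite -mulmxA; apply: Ptv => //; apply: IHr.
(* The first k columns of the matrix are already those of the identity; m counts the remaining
   ones. *)
suff main m k : (k + m = n)%N -> forall A : 'M[F]_n, A \in unitmx ->
    (forall i j : 'I_n, (j < k)%N -> A i j = (i == j)%:R) -> P A.
  by move=> A uA; apply: (main n 0%N).
elim: m k => [|m IHm] k kmn A uA Aid.
  suff -> : A = 1%:M by [].
  by apply/matrixP=> i j; rewrite mxE Aid // -[k]addn0 kmn.
have kn : (k < n)%N by rewrite -kmn addnS ltnS leq_addr.
pose K := Ordinal kn.
have pivot (C : 'M[F]_n) : C \in unitmx ->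
    (forall i j : 'I_n, (j < k)%N -> C i j = (i == j)%:R) -> C K K != 0 -> P C.
  move=> uC Cid CKK.
  (* [B] is the identity with column K replaced by that of [C], so [invmx B *m C] has one more
     standard column. *)
  pose B := (1%:M + (C K K - 1) *: delta_mx K K) *m
    (1%:M + \sum_(i <- [seq i <- enum 'I_n | i != K]) C i K *: delta_mx i K).
  have PB D : P D -> P (B *m D).
    move=> PD; rewrite -mulmxA; apply: Pdil => //; apply: Pcol => //.
    by rewrite mem_filter eqxx.
  have uB : B \in unitmx by rewrite -[B]mulmx1; apply/Punit/PB.
  have BE i j : B i j = if j == K then C i K else (i == j)%:R.
    have sumE l : (\sum_(i <- [seq i <- enum 'I_n | i != K]) C i K *: delta_mx i K) l j
        = ((l != K) && (j == K))%:R * C l K.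
      rewrite big_filter summxE big_enum_cond /=; case: (eqVneq l K) => [->|lK] /=.
        rewrite mul0r big1 // => r rK; rewrite !mxE eq_sym (negPf rK) mulr0 //.
      rewrite (bigD1 l) //= big1 => [|r /andP[_ rl]].
        by rewrite !mxE eqxx addr0 /= mulrC.
      by rewrite !mxE eq_sym (negPf rl) mulr0.
    rewrite /B mul_add1_delta !mxE !sumE eqxx mul0r.
    case: (eqVneq j K) => [->|jK] /=; last first.
      rewrite !andbF; case: (eqVneq K j) jK => [->|]; rewrite ?eqxx //= => _ _.
      by ring.
    rewrite ?eqxx ?andbT; case: (eqVneq i K) => [->|iK] /=; ring.
  have -> : C = B *m (invmx B *m C) by rewrite mulKVmx.
  apply: PB; apply: (IHm k.+1); first by rewrite addSnnS.
    by rewrite unitmx_mul unitmx_inv uB.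
  move=> i j; rewrite ltnS => jk.
  transitivity ((invmx B *m B) i j); last by rewrite mulVmx // mxE.
  rewrite !mxE; apply: eq_bigr => l _; congr (_ * _); rewrite BE.
  case: (eqVneq j K) => [-> //|jK]; rewrite Cid // ltn_neqAle jk andbT.
  by apply: contraNneq jK => jk'; apply/eqP/val_inj.
case: (eqVneq (A K K) 0) => [AKK|]; last exact: pivot.
(* The first k columns of [invmx A] are standard as well. If column K of [A] vanished from row k on,
   the entry (K, K) of [invmx A *m A] would therefore be 0. *)
have [i ki AiK] : exists2 i : 'I_n, (k < i)%N & A i K != 0.
  apply/exists_inP; apply: contraT; rewrite negb_exists_in => /forall_inP noP.
  have: (invmx A *m A) K K = 1 by rewrite mulVmx // mxE eqxx.
  rewrite mxE big1 => [/esym/eqP|l _]; first by rewrite oner_eq0.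
  case: (ltngtP l k) => [lk|kl|lk].
  - suff -> : invmx A K l = 0 by rewrite mul0r.
    have <- : (invmx A *m A) K l = invmx A K l.
      rewrite mxE (bigD1 l) //= Aid // eqxx mulr1 big1 ?addr0 // => r rl.
      by rewrite Aid // (negPf rl) mulr0.
    by rewrite mulVmx // mxE; case: (eqVneq K l) lk => [<-|//]; rewrite ltnn.
  - by move/negPn/eqP: (noP l kl) => ->; rewrite mulr0.
  - by have -> : l = K by [apply: val_inj]; rewrite AKK mulr0.
have Ki : K != i by apply: contraTneq ki => <-; rewrite ltnn.
(* Adding row i to row K turns the pivot into [A i K]. *)
have -> : A = (1%:M + (-1) *: delta_mx K i) *m ((1%:M + 1 *: delta_mx K i) *m A).
  apply/matrixP=> r s; rewrite !mul_add1_delta [i == K]eq_sym (negPf Ki) !mul0r; ring.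
apply: (Ptv _ _ _ _ Ki); apply: pivot.
- by rewrite unitmx_mul uA andbT -[_ + _]mulmx1; apply: Punit; apply: Ptv.
- move=> r s sk; rewrite mul_add1_delta !Aid // (_ : i == s = false) ?mulr0 ?addr0 //.
  by apply: contraTF (ltn_trans sk ki) => /eqP ->; rewrite ltnn.
- by rewrite mul_add1_delta AKK eqxx add0r !mul1r.
Qed.

(** * Derivations and their iterates on a field and on matrices *)

Section Derivations.
Variables (R : fieldType) (d : R -> R).
Hypothesis der_d : derivation d.

Lemma derD a b : d (a + b) = d a + d b. Proof. exact: der_d.1. Qed.
Lemma derM a b : d (a * b) = a * d b + d a * b. Proof. exact: der_d.2. Qed.
Lemma der0 : d 0 = 0.
Proof. by apply: (addrI (d 0)); rewrite -derD !addr0. Qed.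
Lemma derN a : d (- a) = - d a.
Proof. by apply/eqP; rewrite -addr_eq0 -derD addNr der0. Qed.
Lemma derB a b : d (a - b) = d a - d b.
Proof. by rewrite derD derN. Qed.
Lemma der1 : d 1 = 0.
Proof. by apply: (addrI (d 1)); rewrite addr0 -[in RHS](mul1r 1) derM mul1r mulr1. Qed.
Lemma der_nat k : d k%:R = 0.
Proof. by elim: k => [|k IHk]; rewrite ?der0 // -natr1 derD der1 IHk addr0. Qed.
Lemma der_sum (I : Type) (r : seq I) (P : pred I) (F : I -> R) :
  d (\sum_(i <- r | P i) F i) = \sum_(i <- r | P i) d (F i).
Proof. exact: (big_morph d derD der0). Qed.
Lemma derX a k : d (a ^+ k) = k%:R * a ^+ k.-1 * d a.
Proof.
elim: k => [|k IHk]; first by rewrite expr0 der1 !mul0r.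
rewrite exprS derM IHk -natr1 /=; case: k {IHk} => [|k] /=; rewrite ?exprS; ring.
Qed.

Lemma iter_derD k a b : iter k d (a + b) = iter k d a + iter k d b.
Proof. by elim: k => //= k ->; exact: derD. Qed.
Lemma iter_der0 k : iter k d 0 = 0.
Proof. by elim: k => //= k ->; exact: der0. Qed.
Lemma iter_der_sum (I : Type) (r : seq I) (P : pred I) (F : I -> R) k :
  iter k d (\sum_(i <- r | P i) F i) = \sum_(i <- r | P i) iter k d (F i).
Proof. exact: (big_morph _ (iter_derD k) (iter_der0 k)). Qed.
Lemma iter_derM_const k c a : d c = 0 -> iter k d (a * c) = iter k d a * c.
Proof. by move=> dc; elim: k => //= k ->; rewrite derM dc mulr0 add0r. Qed.
Lemma iter_der_const k c : d c = 0 -> iter k d c = (k == 0%N)%:R * c.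
Proof.
move=> dc; case: k => [|k]; first by rewrite mul1r.
by rewrite iterSr dc iter_der0 mul0r.
Qed.
Lemma iter_derX k t i : d t = 1 -> iter k d (t ^+ i) = (i ^_ k)%:R * t ^+ (i - k).
Proof.
move=> dt; elim: k => [|k IHk]; first by rewrite ffactn0 mul1r subn0.
by rewrite /= IHk derM der_nat derX dt ffactnSr natrM subnS; ring.
Qed.

Lemma map_mx_der_mul m n p (A : 'M[R]_(m, n)) (B : 'M[R]_(n, p)) :
  map_mx d (A *m B) = map_mx d A *m B + A *m map_mx d B.
Proof.
apply/matrixP=> i j; rewrite !mxE der_sum -big_split; apply: eq_bigr => k _ /=.
by rewrite !mxE derM addrC.
Qed.

Lemma iter_map_mx k m n (A : 'M[R]_(m, n)) i j :
  iter k (map_mx d) A i j = iter k d (A i j).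
Proof. by elim: k i j => //= k IHk i j; rewrite mxE IHk. Qed.

End Derivations.

(** * Density arguments for differential polynomials *)

(** Polynomiality along every affine line is enough for the density argument and is visibly
    preserved by linear changes of variables. *)
Definition line_poly (R : nzRingType) (V : lmodType R) (F : V -> R) :=
  forall u w, exists q : {poly R}, forall x, q.[x] = F (u + x *: w).

Lemma meval_line_poly (R : fieldType) k (P : {mpoly R[k]}) (u w : 'I_k -> R) :
  exists q : {poly R}, forall x, q.[x] = P.@[fun t => u t + x * w t].
Proof.
exists (\sum_(m <- msupp P) P@_m *: \prod_i ((u i)%:P + 'X * (w i)%:P) ^+ m i) => x.
rewrite mevalE horner_sum; apply: eq_bigr => m _.
rewrite hornerZ horner_prod; congr (_ * _); apply: eq_bigr => i _.
by rewrite horner_exp hornerD hornerM hornerX !hornerC.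
Qed.

Lemma poly0_on_nat (R : fieldType) (q : {poly R}) :
  [pchar R] =i pred0 -> (forall k : nat, q.[k%:R] = 0) -> q = 0.
Proof.
move=> /pcharf0P char0 q0; apply/eqP; apply: contraT => qn0.
have := @max_poly_roots _ q [seq k%:R | k <- iota 0 (size q)] qn0.
rewrite size_map size_iota ltnn => -> //.
  by apply/allP => _ /mapP[k _ ->]; apply/eqP.
rewrite map_inj_uniq ?iota_uniq // => i j ij.
wlog le_ij : i j ij / (i <= j)%N.
  by move=> H; case: (leqP i j) => [/(H _ _ ij)|/ltnW/(H _ _ (esym ij))] ->.
have := char0 (j - i)%N; rewrite natrB // ij subrr eqxx => /esym.
by rewrite subn_eq0 => ji; apply/eqP; rewrite eqn_leq le_ij.
Qed.

(** Coordinates are freed one at a time: along a coordinate line the function is a polynomial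
    vanishing at all natural numbers, hence zero in characteristic zero. *)
Lemma line_poly_eq0_on_nat (R : fieldType) k (G : 'rV[R]_k -> R) :
  [pchar R] =i pred0 -> line_poly G ->
  (forall c : 'I_k -> nat, G (\row_i (c i)%:R) = 0) -> forall v, G v = 0.
Proof.
move=> char0 Gline G0.
(* Coordinates below j are arbitrary, the others are natural numbers. *)
suff main j : (j <= k)%N -> forall v : 'rV_k,
    (forall i : 'I_k, (j <= i)%N -> exists c : nat, v 0 i = c%:R) -> G v = 0.
  by move=> v; apply: (main k) => // i; rewrite leqNgt ltn_ord.
elim: j => [_ v /(_ _ isT) vnat|j IHj jk v vnat].
  have [c vE] := fin_all_exists vnat.
  by rewrite -[RHS](G0 c); congr G; apply/rowP => i; rewrite mxE.
pose J := Ordinal jk.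
have [q qE] := Gline (v - v 0 J *: delta_mx 0 J) (delta_mx 0 J).
suff q0 : q = 0 by rewrite -(subrK (v 0 J *: delta_mx 0 J) v) -qE q0 horner0.
apply: poly0_on_nat => // c; rewrite qE; apply: IHj => [|i ji]; first exact: ltnW.
case: (eqVneq i J) => [->|iJ].
  by exists c; rewrite !mxE !eqxx /=; ring.
have [|b vb] := vnat i.
  by rewrite ltn_neqAle ji andbT; apply: contraNneq iJ => jE; apply/eqP/val_inj.
by exists b; rewrite !mxE (negPf iJ) andbF vb !mulr0 subr0 addr0.
Qed.

(* [D - D t * d] vanishes on the polynomials in [t] with coefficients in the
   natural numbers; the jets of [1, t, t^2, ...] form an invertible triangular
   matrix [W], so this forces its differential polynomial to vanish. *)
Lemma diff_poly_derivation (R : fieldType) (d D : R -> R) (t : R) m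
    (F : 'rV[R]_m.+2 -> R) :
  [pchar R] =i pred0 -> derivation d -> derivation D -> d t = 1 ->
  line_poly F -> (forall a, D a = F (\row_k iter k d a)) ->
  forall a, D a = D t * d a.
Proof.
move=> char0 der_d der_D dt Fline DF.
pose jt a := (\row_(k < m.+2) iter k d a).
pose W := \matrix_(i < m.+2, k < m.+2) iter k d (t ^+ i).
(* The slot of the jet that holds [d a]; jets have at least two slots so that it exists. *)
pose j1 : 'I_m.+2 := lift ord0 ord0.
pose G (v : 'rV_m.+2) := F (v *m W) - D t * (v *m W) 0 j1.
(* The k-th derivative of t^i vanishes for k > i and equals i! for k = i, which is nonzero in
   characteristic zero. *)
have uW : W \in unitmx.
  rewrite unitmxE det_trig ?unitfE.
    apply/prodf_neq0 => i _.
    by rewrite mxE iter_derX // ffactnn subnn mulr1 ((pcharf0P R).1 char0)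
      -lt0n fact_gt0.
  by apply/is_trig_mxP => i k ik; rewrite mxE iter_derX // ffact_small // mul0r.
have Gline : line_poly G.
  move=> u w; have [q qE] := Fline (u *m W) (w *m W).
  exists (q - (D t)%:P * (((u *m W) 0 j1)%:P + 'X * ((w *m W) 0 j1)%:P)) => x.
  rewrite hornerD hornerN hornerM hornerD hornerM hornerX !hornerC qE /G.
  rewrite mulmxDl -scalemxAl; congr (_ - _ * _).
  by rewrite [RHS]mxE [X in _ = _ + X]mxE.
have jt_nat (c : 'I_m.+2 -> nat) :
    (\row_i (c i)%:R) *m W = jt (\sum_(i < m.+2) t ^+ i * (c i)%:R).
  apply/rowP => k; rewrite !mxE iter_der_sum //; apply: eq_bigr => i _.
  by rewrite !mxE (iter_derM_const der_d) 1?mulrC ?(der_nat der_d).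
have G0 : forall v, G v = 0.
  apply: line_poly_eq0_on_nat => // c; rewrite /G jt_nat -DF mxE /=.
  apply/eqP; rewrite subr_eq0; apply/eqP.
  rewrite (der_sum der_D) (der_sum der_d) mulr_sumr; apply: eq_bigr => i _.
  rewrite (derM der_D) (derM der_d) !(der_nat der_D, der_nat der_d).
  by rewrite !(derX der_D, derX der_d) dt; ring.
(* Since [W] is invertible, every jet has the form [v *m W]. *)
move=> a; have := G0 (jt a *m invmx W); rewrite /G mulmxKV // -DF mxE /= => /eqP.
by rewrite subr_eq0 => /eqP.
Qed.

(** Blum's axiom in order one, for the equation y' - 1 = 0 and the inequation 1 != 0. *)
Lemma delta_closed_parameter (R : fieldType) (d : R -> R) :
  delta_closed d -> exists t, d t = 1.
Proof.
move=> clo; have [|||a [fa _]] := clo 1%N ('X_ord_max - 1) 1.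
- exists U_(ord_max)%MM; last by rewrite mnm1E eqxx.
  rewrite mcoeff_msupp mcoeffB mcoeffXU mcoeff1 eqxx mnm1_eq0 subr0; exact: oner_neq0.
- exact: oner_neq0.
- by move=> mo; rewrite mcoeff_msupp mcoeff1; case: (eqVneq mo 0%MM) => [->|_];
    rewrite ?mnm0E ?eqxx.
exists a; move: fa; rewrite /deval mevalB mevalXU meval1 /= => /eqP.
by rewrite subr_eq0 => /eqP.
Qed.

(** * Algebraic groups of the form 1 + b M and their Lie algebras *)

Definition line_group (R : fieldType) n (M g : 'M[R]_n) : Prop :=
  g \in unitmx /\ exists b, g = 1%:M + b *: M.

Lemma mul_add1_line (R : fieldType) n (M : 'M[R]_n) mu a b :
  M *m M = mu *: M ->
  (1%:M + a *: M) *m (1%:M + b *: M) = 1%:M + (a + b + a * b * mu) *: M.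
Proof.
move=> MM; rewrite mulmxDl mul1mx mulmxDr mulmx1 -scalemxAl -scalemxAr MM.
by rewrite !scalerA !scalerDl -!addrA [b *: M + _]addrCA.
Qed.

(** From (1 + b M) M = (1 + b mu) M, the inverse is 1 - b / (1 + b mu) M; by invertibility the
    scalar 1 + b mu vanishes only if M = 0. *)
Lemma invmx_add1_line (R : fieldType) n (M : 'M[R]_n) mu b :
  M *m M = mu *: M -> 1%:M + b *: M \in unitmx ->
  exists c, invmx (1%:M + b *: M) = 1%:M + c *: M.
Proof.
move=> MM uE; set E := 1%:M + b *: M in uE *.
have NE : invmx E *m E = 1%:M by rewrite mulVmx.
have EM : E *m M = (1 + b * mu) *: M.
  by rewrite mulmxDl mul1mx -scalemxAl MM scalerA scalerDl scale1r.
have NM : M = (1 + b * mu) *: (invmx E *m M) by rewrite scalemxAr -EM mulKmx.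
have NEq : invmx E = 1%:M - b *: (invmx E *m M).
  by rewrite -NE /E mulmxDr mulmx1 -scalemxAr addrK.
case: (eqVneq (1 + b * mu) 0) => [mu0|mu1].
  have M0 : M = 0 by rewrite NM mu0 scale0r.
  by exists 0; rewrite NEq M0 mulmx0 !scaler0 subr0 addr0.
exists (- (b / (1 + b * mu))); rewrite NEq scaleNr; congr (_ - _).
by rewrite [in RHS]NM scalerA mulfVK.
Qed.

Section LineGroups.
Variables (R : fieldType) (d : R -> R) (n : nat) (M : 'M[R]_n) (mu : R).
Variables (i0 j0 : 'I_n).
Hypotheses (der_d : derivation d) (dM : forall i j, d (M i j) = 0).
Hypotheses (MM : M *m M = mu *: M) (M1 : M i0 j0 = 1).

(** The entry (i0, j0), where [M] equals 1, recovers the parameter b; each entry is then an affine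
    function of it with constant coefficients. *)
Let eqn (i j : 'I_n) : {mpoly R[n * n]} :=
  'X_(mxvec_index i j) - M i j *: 'X_(mxvec_index i0 j0)
  - ((i == j)%:R - M i j * (i0 == j0)%:R)%:MP.

Lemma line_group_eqnP (g : 'M[R]_n) :
  (exists b, g = 1%:M + b *: M) <-> forall i j, (eqn i j).@[mxcoord g] = 0.
Proof.
have eqnE i j : (eqn i j).@[mxcoord g] =
    g i j - (M i j * g i0 j0 + ((i == j)%:R - M i j * (i0 == j0)%:R)).
  by rewrite /eqn !mevalB mevalZ !mevalXU mevalC /mxcoord !mxvecE; ring.
split=> [[b gE] i j|g0].
  by rewrite eqnE gE !mxE M1; ring.
exists (g i0 j0 - (i0 == j0)%:R); apply/matrixP => i j; apply/eqP.
move/eqP: (g0 i j); rewrite eqnE subr_eq0 => /eqP ->; rewrite !mxE.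
by apply/eqP; ring.
Qed.

Lemma alg_subgroup_line_group : alg_subgroup_const d (line_group M).
Proof.
split=> [g []//||g h|g|].
- by split; [rewrite unitmx1 | exists 0; rewrite scale0r addr0].
- move=> [ug [a gE]] [uh [b hE]]; split; first by rewrite unitmx_mul ug.
  by rewrite gE hE (mul_add1_line _ _ MM); exists (a + b + a * b * mu).
- move=> [ug [a gE]]; rewrite gE in ug *; split; first by rewrite unitmx_inv.
  exact: invmx_add1_line MM ug.
exists (fun p => exists i j, p = eqn i j); split.
  move=> _ [i [j ->]] mo.
  rewrite /eqn !mcoeffB mcoeffZ !mcoeffX mcoeffC.
  rewrite !(derB der_d, derM der_d, der_nat der_d, dM).
  by rewrite !(mulr0, mul0r, addr0, subr0).
move=> g ug; split=> [[_ /line_group_eqnP g0] _ [i [j ->]] //|g0].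
by split=> //; apply/line_group_eqnP => i j; apply: g0; exists i, j.
Qed.

(** The differential of [eqn i j] at the identity is [A i j - M i j * A i0 j0]. *)
Lemma lie_alg_line_group (A : 'M[R]_n) :
  lie_alg (line_group M) A -> A = A i0 j0 *: M.
Proof.
move=> lieA; apply/matrixP => i j.
have: \sum_(t < n * n) ((eqn i j)^`M(t)).@[mxcoord 1%:M] * mxcoord A t = 0.
  by apply: lieA => g [_ /line_group_eqnP].
have derivX s t v : (('X_s : {mpoly R[n * n]})^`M(t)).@[v] = (s == t)%:R.
  rewrite mderivX mevalZ mnm1E; case: (eqVneq s t) => [->|_]; last by rewrite mul0r.
  have -> : (U_(t) - U_(t) = 0)%MM by apply/mnmP => k; rewrite mnmBE subnn mnm0E.
  by rewrite mpolyX0 meval1 mul1r.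
have sumX s : \sum_(t < n * n) (s == t)%:R * mxcoord A t = mxcoord A s.
  rewrite (bigD1 s) //= eqxx mul1r big1 ?addr0 // => t ts.
  by rewrite eq_sym (negPf ts) mul0r.
under eq_bigr => t _ do
  rewrite /eqn !mderivB mderivZ mderivC subr0 mevalB mevalZ !derivX mulrBl -mulrA.
rewrite sumrB -mulr_sumr !sumX /mxcoord !mxvecE => /eqP.
by rewrite subr_eq0 !mxE mulrC => /eqP.
Qed.

Lemma coherent_line f b : delta_coherent d f -> 1%:M + b *: M \in unitmx ->
  f (1%:M + b *: M) = f (1%:M + b *: M) i0 j0 *: M.
Proof.
move=> coh uE; apply: lie_alg_line_group.
by apply: coh; [exact: alg_subgroup_line_group | split; last by exists b].
Qed.

End LineGroups.

(** * Transvections, dilations and their commutation relations *)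

Lemma mul_add1_deltar (F : fieldType) n (i j : 'I_n) a (A : 'M[F]_n) r s :
  (A *m (1%:M + a *: delta_mx i j)) r s = A r s + (s == j)%:R * a * A r i.
Proof.
rewrite mulmxDr mulmx1 -scalemxAr !mxE; congr (_ + _).
rewrite (bigD1 i) //= big1 => [|l li]; first by rewrite mxE eqxx /=; ring.
by rewrite mxE (negPf li) mulr0.
Qed.

Lemma add1_line_inv (R : fieldType) n (M : 'M[R]_n) mu a b :
  M *m M = mu *: M -> a + b + a * b * mu = 0 ->
  1%:M + a *: M \in unitmx /\ invmx (1%:M + a *: M) = 1%:M + b *: M.
Proof.
move=> MM ab.
have AB : (1%:M + a *: M) *m (1%:M + b *: M) = 1%:M.
  by rewrite (mul_add1_line _ _ MM) ab scale0r addr0.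
have [uA _] := mulmx1_unit AB.
by split=> //; rewrite -[RHS](mulKmx uA) AB mulmx1.
Qed.

Lemma delta_mx_sqr (R : fieldType) n (i j : 'I_n) :
  delta_mx i j *m delta_mx i j = (i == j)%:R *: delta_mx i j :> 'M[R]_n.
Proof. by rewrite mul_delta_mx_cond scaler_nat eq_sym. Qed.

Section Elementary.
Variables (R : fieldType) (n : nat).
Implicit Types (i j : 'I_n) (a b : R).

Definition transvection i j a : 'M[R]_n := 1%:M + a *: delta_mx i j.
(** The shift [a - 1] puts [a] at diagonal position i while keeping the shape 1 + b M of a line
    group. *)
Definition dilation i a : 'M[R]_n := 1%:M + (a - 1) *: delta_mx i i.

Lemma transvection_inv i j a : i != j ->
  transvection i j a \in unitmx /\
  invmx (transvection i j a) = transvection i j (- a).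
Proof.
move=> ij; apply: (add1_line_inv (delta_mx_sqr R i j)).
by rewrite (negPf ij) mulr0 addr0 subrr.
Qed.

Lemma dilation_inv i a : a != 0 ->
  dilation i a \in unitmx /\ invmx (dilation i a) = dilation i a^-1.
Proof.
by move=> a0; apply: (add1_line_inv (delta_mx_sqr R i i)); rewrite eqxx mulr1; field.
Qed.

Lemma transvectionD i j a b : i != j ->
  transvection i j (a + b) = transvection i j a *m transvection i j b.
Proof.
move=> ij; rewrite (mul_add1_line _ _ (delta_mx_sqr R i j)) (negPf ij) mulr0.
by rewrite addr0.
Qed.

Lemma dilation_transvectionl i j a b : i != j ->
  dilation i a *m transvection i j b = transvection i j (a * b) *m dilation i a.
Proof.
move=> ij; rewrite /dilation /transvection !mulmxDl !mulmxDr !mul1mx !mulmx1.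
rewrite -!scalemxAl -!scalemxAr mul_delta_mx mul_delta_mx_0 1?eq_sym // !scaler0.
by apply/matrixP => r s; rewrite !mxE; ring.
Qed.

Lemma dilation_transvectionr i j a b : i != j ->
  dilation j a *m transvection i j (a * b) = transvection i j b *m dilation j a.
Proof.
move=> ij; rewrite /dilation /transvection !mulmxDl !mulmxDr !mul1mx !mulmx1.
rewrite -!scalemxAl -!scalemxAr mul_delta_mx mul_delta_mx_0 1?eq_sym // !scaler0.
by apply/matrixP => r s; rewrite !mxE; ring.
Qed.

(** Commuting with the dilation by 2 turns the transvection u into its square, so det u = (det
    u)^2. *)
Lemma det_transvection i j a : 2%:R != 0 :> R -> i != j ->
  \det (transvection i j a) = 1.
Proof.
move=> two ij; have [uu _] := transvection_inv a ij.
have [ut _] := dilation_inv i two; rewrite !unitmxE !unitfE in uu ut.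
have := congr1 determinant (dilation_transvectionl 2%:R a ij).
rewrite mulr_natl mulr2n transvectionD // !det_mulmx mulrC => /(mulIf ut).
by rewrite -[LHS]mul1r => /(mulIf uu).
Qed.

End Elementary.

(** * The coherent cocycle on transvections and dilations *)

Lemma jet_add1_line (R : fieldType) (d : R -> R) n m (M : 'M[R]_n) a t :
  derivation d -> (forall i j, d (M i j) = 0) ->
  @jet R n d m (1%:M + a *: M) t =
  mxvec (\matrix_(k < m.+1, l < n * n)
    mxvec ((nat_of_ord k == 0%N)%:R *: 1%:M + iter k d a *: M) 0 l) 0 t.
Proof.
move=> der_d dM; rewrite /jet; congr (mxvec _ 0 t).
apply/matrixP => k l; rewrite !mxE; case/mxvec_indexP: l => r s.
rewrite !mxvecE iter_map_mx !mxE (iter_derD der_d) (iter_derM_const der_d) ?dM //.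
by rewrite (iter_der_const der_d) ?(der_nat der_d).
Qed.

Section Cocycle.
Variables (R : fieldType) (d : R -> R) (n : nat) (f : 'M[R]_n -> 'M[R]_n).
Hypotheses (char0 : [pchar R] =i pred0) (der_d : derivation d).
Hypothesis (fM : forall g1 g2, g1 \in unitmx -> g2 \in unitmx ->
  f (g1 *m g2) = f g1 + g1 *m f g2 *m invmx g1).
Hypotheses (coh : delta_coherent d f).

Implicit Types (i j : 'I_n) (a b : R).

Let two_neq0 : 2%:R != 0 :> R.
Proof. by rewrite ((pcharf0P R).1 char0). Qed.

Let phi i j a := f (transvection i j a) i j.
Let psi i a := f (dilation i a) i i.

Let d_delta (i j r s : 'I_n) : d ((delta_mx i j : 'M[R]_n) r s) = 0.
Proof. by rewrite mxE der_nat. Qed.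

Lemma cocycle_transvection i j a : i != j ->
  f (transvection i j a) = phi i j a *: delta_mx i j.
Proof.
move=> ij; have [uu _] := transvection_inv a ij.
by apply: (coherent_line der_d _ (delta_mx_sqr R i j)) => //; rewrite mxE !eqxx.
Qed.

Lemma cocycle_dilation i a : a != 0 ->
  f (dilation i a) = psi i a *: delta_mx i i.
Proof.
move=> a0; have [ut _] := dilation_inv i a0.
by apply: (coherent_line der_d _ (delta_mx_sqr R i i)) => //; rewrite mxE !eqxx.
Qed.

Lemma phiD i j a b : i != j -> phi i j (a + b) = phi i j a + phi i j b.
Proof.
move=> ij; have [ua iua] := transvection_inv a ij.
have [ub _] := transvection_inv b ij.
rewrite {1}/phi transvectionD // fM // iua (cocycle_transvection b) // mxE.
rewrite mul_add1_deltar !mul_add1_delta !mxE !eqxx [j == i]eq_sym (negPf ij) /=.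
by rewrite /phi; ring.
Qed.

(** Entry (i, j) of f on both sides of [dilation_transvectionl]: conjugation by the dilation
    multiplies e_ij by a, and conjugation by the transvection sends e_ii to e_ii - ab e_ij. *)
Lemma phiM_psil i j a b : i != j -> a != 0 ->
  phi i j (a * b) = a * phi i j b + a * b * psi i a.
Proof.
move=> ij a0; have [ua iua] := transvection_inv (a * b) ij.
have [ub _] := transvection_inv b ij; have [ut iut] := dilation_inv i a0.
have := congr1 (fun g => f g i j) (dilation_transvectionl a b ij).
rewrite /= !fM // iua iut !(cocycle_transvection _ ij, cocycle_dilation _ a0).
rewrite [LHS]mxE [RHS]mxE !mul_add1_deltar !mul_add1_delta !mxE !eqxx.
rewrite [j == i]eq_sym (negPf ij) /=.
rewrite !(mulr0, mul0r, mulr1, mul1r, addr0, add0r) => E.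
apply: (addIr (- (a * b) * psi i a)); rewrite -E; ring.
Qed.

(** The same comparison with a dilation at j, which conjugates e_ij to a^-1 e_ij; the resulting
    identity is multiplied by a. *)
Lemma phiM_psir i j a b : i != j -> a != 0 ->
  phi i j (a * b) = a * phi i j b + a * b * psi j a.
Proof.
move=> ij a0; have [ua iua] := transvection_inv b ij.
have [ub _] := transvection_inv (a * b) ij; have [ut iut] := dilation_inv j a0.
have := congr1 (fun g => f g i j) (dilation_transvectionr a b ij).
rewrite /= !fM // iua iut !(cocycle_transvection _ ij, cocycle_dilation _ a0).
rewrite [LHS]mxE [RHS]mxE !mul_add1_deltar !mul_add1_delta !mxE !eqxx.
rewrite [j == i]eq_sym (negPf ij) /=.
rewrite !(mulr0, mul0r, mulr1, mul1r, addr0, add0r) => E.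
transitivity (a * (phi i j (a * b) + (a^-1 - 1) * phi i j (a * b))); first by field.
by rewrite E; ring.
Qed.

(* Conjugating the torus of dilations by [transvection i j 1] gives another
   torus defined over the constants; coherence along both is incompatible
   with [phi i j 1 != 0]. *)
Lemma phi1 i j : i != j -> phi i j 1 = 0.
Proof.
move=> ij; have [uu iu] := transvection_inv (1 : R) ij.
have [ut _] := dilation_inv i two_neq0.
have ji : j != i by rewrite eq_sym.
have dji k : delta_mx i j *m delta_mx i k = 0 :> 'M[R]_n by apply: mul_delta_mx_0.
have dii k : delta_mx i i *m delta_mx i k = delta_mx i k :> 'M[R]_n.
  by apply: mul_delta_mx.
pose M : 'M[R]_n := delta_mx i i - delta_mx i j.
have Mi (k : 'I_n) : M *m delta_mx i k = delta_mx i k.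
  by rewrite mulmxBl dii dji subr0.
have iM : delta_mx i j *m M = 0 by rewrite mulmxBr !dji subr0.
have MM : M *m M = 1 *: M by rewrite {2}/M mulmxBr !Mi scale1r.
have Mii : M i i = 1 by rewrite !mxE !eqxx (negPf ij) subr0.
have dM r s : d (M r s) = 0 by rewrite !mxE (derB der_d) !(der_nat der_d) subrr.
pose g := 1%:M + 1 *: M.
have [ug ig] : g \in unitmx /\ invmx g = 1%:M + (- 2%:R^-1) *: M.
  by apply: (add1_line_inv MM); field.
(* With u the transvection, M = u e_ii u^-1, so [g] is the conjugate by u of the dilation by 2. *)
have gu : g *m transvection i j 1 = transvection i j 1 *m dilation i 2%:R.
  rewrite /g /dilation /transvection !mulmxDl !mulmxDr !mul1mx !mulmx1 !scale1r.
  rewrite -!scalemxAr Mi dji.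
  by apply/matrixP => r s; rewrite !mxE; ring.
have gE : g *m delta_mx i j = 2%:R *: delta_mx i j.
  by rewrite mulmxDl mul1mx scale1r Mi scaler_nat mulr2n.
have Eg : delta_mx i j *m invmx g = delta_mx i j.
  by rewrite ig mulmxDr mulmx1 -scalemxAr iM scaler0 addr0.
have fg : f g = f g i i *: M by apply: (coherent_line der_d dM MM Mii).
have := congr1 f gu.
rewrite !fM // iu (cocycle_transvection _ ij) (cocycle_dilation _ two_neq0).
rewrite -scalemxAr gE -!scalemxAl Eg fg => E.
have Eii : f g i i = psi i 2%:R.
  have := congr1 (fun A : 'M_n => A i i) E; rewrite /= [LHS]mxE [RHS]mxE.
  rewrite !mul_add1_deltar !mul_add1_delta !mxE !eqxx (negPf ij) (negPf ji) /=.
  by rewrite !(mulr0, mul0r, mulr1, mul1r, addr0, add0r, subr0).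
(* Writing psi for [psi i 2] and phi for [phi i j 1], this entry reads -psi + 2 phi = phi - psi. *)
have := congr1 (fun A : 'M_n => A i j) E; rewrite /= [LHS]mxE [RHS]mxE.
rewrite !mul_add1_deltar !mul_add1_delta !mxE !eqxx (negPf ji) /=.
rewrite !(mulr0, mul0r, mulr1, mul1r, addr0, add0r, sub0r) Eii => Eij.
transitivity (psi i 2%:R * -1 + phi i j 1 * 2%:R - (phi i j 1 + -1 * psi i 2%:R)).
  by ring.
by rewrite Eij subrr.
Qed.

Lemma phi_psi i j a : i != j -> a != 0 ->
  phi i j a = a * psi i a /\ phi i j a = a * psi j a.
Proof.
move=> ij a0; have := phiM_psil 1 ij a0; have := phiM_psir 1 ij a0.
by rewrite (phi1 ij) mulr0 !add0r mulr1; split.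
Qed.

Lemma psi_indep i j a : a != 0 -> psi i a = psi j a.
Proof.
move=> a0; case: (eqVneq i j) => [-> //|ij].
by apply: (mulfI a0); have [<- <-] := phi_psi ij a0.
Qed.

Lemma phi_derivation i j : i != j -> derivation (phi i j).
Proof.
move=> ij; split=> [a b|a b]; first exact: phiD.
(* The dilation by 0 is singular, so a = 0 is settled by additivity. *)
case: (eqVneq a 0) => [->|a0].
  have phi0 : phi i j 0 = 0 by apply: (addrI (phi i j 0)); rewrite -phiD // !addr0.
  by rewrite !mul0r phi0 mul0r addr0.
by rewrite phiM_psil // (phi_psi ij a0).1; ring.
Qed.

(** Transvections have determinant 1, which removes the denominator, and their jets are affine in
    the jet of a. [F] ignores its last coordinate, added so that the slot of [d a] exists even when
    m = 0. *)
Lemma phi_diff_poly i j : i != j -> delta_map d f ->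
  exists m (F : 'rV[R]_m.+2 -> R), line_poly F /\
    forall a, phi i j a = F (\row_k iter k d a).
Proof.
move=> ij [m [N [P fP]]].
(* [J 1] is the affine map from jets of a to jets of the transvection and [J 0] its linear part, so
   J 1 (u + x w) = J 1 u + x J 0 w. *)
pose J (e : R) (v : 'rV[R]_m.+2) (t : 'I_(m.+1 * (n * n))) := mxvec
  (\matrix_(k < m.+1, l < n * n)
    mxvec ((e * (nat_of_ord k == 0%N)%:R) *: 1%:M
      + v 0 (widen_ord (leqnSn _) k) *: delta_mx i j : 'M[R]_n) 0 l) 0 t.
exists m, (fun v => (P i j).@[J 1 v]); split=> [u w|a].
  have [q qE] := meval_line_poly (P i j) (J 1 u) (J 0 w).
  exists q => x; rewrite qE; apply: meval_eq => t; rewrite /J.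
  case/mxvec_indexP: t => k l; rewrite !mxvecE !mxE; case/mxvec_indexP: l => r s.
  by rewrite !mxvecE !mxE; ring.
have [uu _] := transvection_inv a ij.
rewrite /phi fP // det_transvection // expr1n divr1; apply: meval_eq => t.
rewrite jet_add1_line //; congr (mxvec _ 0 t).
by apply/matrixP => k l; rewrite !mxE /= mul1r.
Qed.

End Cocycle.

(** * Comparison with the logarithmic derivative on generators *)

Theorem theorem1p4 (R : fieldType) (d : R -> R) (n : nat)
  (f : 'M[R]_n -> 'M[R]_n) :
  [pchar R] =i pred0 ->
  derivation d ->
  delta_closed d ->
  (2 <= n)%N ->
  delta_map d f ->
  (forall g1 g2, g1 \in unitmx -> g2 \in unitmx ->
     f (g1 *m g2) = f g1 + g1 *m f g2 *m invmx g1) ->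
  delta_coherent d f ->
  exists nu : R, forall g, g \in unitmx ->
    f g = nu *: (map_mx d g *m invmx g).
Proof.
move=> char0 der_d clo n2 fdelta fM coh.
have [t dt] := delta_closed_parameter clo.
pose i0 : 'I_n := Ordinal (ltnW n2); pose i1 : 'I_n := Ordinal n2.
have i01 : i0 != i1 by [].
have [m [F [Fline FE]]] := phi_diff_poly char0 der_d i01 fdelta.
have der_phi := phi_derivation char0 der_d fM coh i01.
have phiE := diff_poly_derivation char0 der_d der_phi dt Fline FE.
(* [nu] is the value at t of the derivation phi; since [d t = 1], phi equals nu times d. *)
set nu := f _ i0 i1 in phiE.
have psiE (i : 'I_n) a : a != 0 -> f (dilation i a) i i = nu * (d a / a).
  move=> a0; rewrite (psi_indep char0 der_d fM coh i i0 a0); apply: (mulfI a0).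
  by rewrite -(phi_psi char0 der_d fM coh i01 a0).1 phiE; field.
have tvE (i j : 'I_n) a : i != j -> f (transvection i j a) i j = nu * d a.
  move=> ij; case: (eqVneq a 0) => [->|a0].
    rewrite (der0 (phi_derivation char0 der_d fM coh ij)).
    by rewrite (der0 der_d) mulr0.
  by rewrite (phi_psi char0 der_d fM coh ij a0).1 psiE //; field.
exists nu.
have dline (i j : 'I_n) a :
    map_mx d (1%:M + a *: delta_mx i j) = d a *: delta_mx i j.
  apply/matrixP => r s; rewrite !mxE (derD der_d) (derM der_d) !(der_nat der_d).
  by rewrite mulr0 !add0r.
pose P g := g \in unitmx /\ f g = nu *: (map_mx d g *m invmx g).
(* Both f and nu times the logarithmic derivative are cocycles, so the matrices on which they agree
   are closed under products. *)
have PM e g : P e -> P g -> P (e *m g).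
  move=> [ue fe] [ug fg]; split; first by rewrite unitmx_mul ue.
  have ueg : e *m g \in unitmx by rewrite unitmx_mul ue.
  have -> : invmx (e *m g) = invmx g *m invmx e.
    by rewrite -[RHS](mulKmx ueg) -(mulmxA e) mulKVmx // mulmxV // mulmx1.
  rewrite fM // fe fg (map_mx_der_mul der_d) mulmxDl scalerDr mulmxA mulmxK //.
  by rewrite -scalemxAr -scalemxAl !mulmxA.
suff Pall g : g \in unitmx -> P g by move=> g /Pall[].
apply: (@unitmx_elementary_ind R n P) => [A []//||i a A a0|i j a A ij].
- split; first exact: unitmx1.
  rewrite (_ : map_mx d 1%:M = 0) ?mul0mx ?scaler0; last first.
    by apply/matrixP => r s; rewrite !mxE (der_nat der_d).
  (* The cocycle identity at the pair (1, 1) gives f 1 = f 1 + f 1. *)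
  have := fM 1%:M 1%:M (unitmx1 _ _) (unitmx1 _ _).
  by rewrite invmx1 !mulmx1 mul1mx => /esym/eqP; rewrite -subr_eq0 addrK => /eqP.
- apply: PM; have [ue ie] := dilation_inv i a0; split => //.
  (* The logarithmic derivative of the dilation is (d a / a) e_ii; for the transvection below it is
     d a e_ij, because e_ij squares to zero. *)
  rewrite (cocycle_dilation der_d coh i a0) psiE // dline ie.
  rewrite /dilation mulmxDr mulmx1 -scalemxAl -scalemxAr mul_delta_mx.
  rewrite !scalerA -scalerDl scalerA (derB der_d) (der1 der_d); congr (_ *: _).
  by field.
- apply: PM; have [ue ie] := transvection_inv a ij; split => //.
  rewrite (cocycle_transvection der_d coh a ij) tvE // dline ie.
  rewrite /transvection mulmxDr mulmx1 -scalemxAl -scalemxAr.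
  by rewrite mul_delta_mx_0 1?eq_sym // !scaler0 addr0 scalerA.
Qed.
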